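(* The implication ''if a finite group $G$ has a linear character of order $p$, then $p\in C_{\mathrm{char}}(G)$'' fails for every odd prime $p$: for every odd prime $p$, the cyclic group $C_p$ of order $p$ has a linear character of order $p$, yet $C_{\mathrm{char}}(C_p)=\emptyset$; in particular $p\notin C_{\mathrm{char}}(C_p)$.
   Context: Character probe: for a finite group $G$ and $\chi\in\operatorname{Irr}(G)$ (irreducible complex characters), the Galois-orbit trace of $\chi$ is the integer-valued class function $$\operatorname{OrbTr}(\chi)(c)=\sum_{\psi\in\operatorname{Gal}(\overline{\mathbb{Q}}/\mathbb{Q})\cdot\chi}\psi(c),$$ the sum over the distinct characters in the Galois orbit of $\chi$, evaluated at conjugacy classes $c$ of $G$. Let $P$ be the integer matrix with rows indexed by $\operatorname{Irr}(G)$, columns indexed by the conjugacy classes of $G$, and entries $P_{\chi,c}=\operatorname{OrbTr}(\chi)(c)$. Let $M_{\mathrm{char}}(G)$ be the $\mathbb{Z}$-span of all differences of rows $P_\chi-P_{\chi'}$. The character conductor is the set of primes $C_{\mathrm{char}}(G)=\{p\text{ prime}:\operatorname{rank}_{\mathbb{F}_p}(M_{\mathrm{char}}(G)\bmod p)<\operatorname{rank}_{\mathbb{Q}}M_{\mathrm{char}}(G)\}$. *)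

(* Defs.v *)
From mathcomp Require Import all_boot all_order all_algebra.
From mathcomp Require Import all_fingroup all_solvable all_field all_character.
From mathcomp Require Import boolp.

Set Implicit Arguments.
Unset Strict Implicit.
Unset Printing Implicit Defensive.

Import Order.TTheory GroupScope GRing.Theory Num.Theory.
Local Open Scope ring_scope.

Section OrbitTrace.

Variables (gT : finGroupType) (G : {group gT}).

(* The complex characters of G take their values in algC, the field of all    *)
(* algebraic numbers, whose bijective ring endomorphisms are exactly the      *)
(* elements of Gal(Qbar / Q).                                                 *)
Definition galois_conj (i j : Iirr G) : Prop :=
  exists2 u : {rmorphism algC -> algC}, bijective u & j = aut_Iirr u i.

Definition galois_orbit (i : Iirr G) : {set Iirr G} :=
  [set j | `[< galois_conj i j >]].

Definition orb_tr (i : Iirr G) : 'CF(G) :=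
  \sum_(j in galois_orbit i) 'chi_j.

(* Num.floor only changes the type of the entries from algC to int: by        *)
(* probe_mxE below, the entries of probe_mx are the values of orb_tr.         *)
Definition probe_mx : 'M[int]_(Nirr G, #|classes G|) :=
  \matrix_(i, c) Num.floor (orb_tr i (repr (enum_val c))).

Definition row_diffs : seq 'rV[int]_#|classes G| :=
  [seq row ij.1 probe_mx - row ij.2 probe_mx | ij : Iirr G * Iirr G].

Definition M_char : 'rV[int]_#|classes G| -> Prop :=
  inIntSpan (in_tuple row_diffs).

End OrbitTrace.

Arguments M_char {gT} G _.

(* The largest number of vectors of M whose images in F^n are linearly        *)
(* independent over F. When M is a subgroup of Z^n, this is the rank of M for *)
(* F = Q, and the dimension of the image of M in (F_p)^n for F = F_p.         *)
Definition rank_over (F : fieldType) n (M : 'rV[int]_n -> Prop) : nat :=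
  \max_(r < n.+1 | `[< exists2 A : 'M[int]_(r, n),
      forall i, M (row i A) & row_free (map_mx intr A : 'M[F]_(r, n)) >]) r.

Definition C_char gT (G : {group gT}) : pred nat :=
  [pred p | prime p
    && (rank_over 'F_p (M_char G) < rank_over rat (M_char G))%N].

Lemma aut_galois_orbit gT (G : {group gT}) (u : {rmorphism algC -> algC})
    (i j : Iirr G) :
  (aut_Iirr u j \in galois_orbit i) = (j \in galois_orbit i).
Proof.
have bij_aut (v : {rmorphism algC -> algC}) : bijective v.
  by exists (algC_invaut v); [apply: algC_autK | apply: algC_invautK].
rewrite !inE; apply/asboolP/asboolP=> -[v _ Dj].
  exists (algC_invaut u \o v : {rmorphism algC -> algC}); first exact: bij_aut.
  apply/irr_inj/cfunP=> x; move/(congr1 (fun k => 'chi_k x)): Dj.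
  by rewrite !aut_IirrE !cfunE /= => <-; rewrite algC_autK.
exists (u \o v : {rmorphism algC -> algC}); first exact: bij_aut.
by apply/irr_inj/cfunP=> x; rewrite Dj !aut_IirrE !cfunE.
Qed.

Lemma aut_orb_tr gT (G : {group gT}) (u : {rmorphism algC -> algC})
    (i : Iirr G) x :
  u (orb_tr i x) = orb_tr i x.
Proof.
have inj_u: injective (@aut_Iirr gT G u).
  move=> j k /(congr1 (fun l : Iirr G => 'chi_l)).
  by rewrite !aut_IirrE => /cfAut_inj/irr_inj.
rewrite /orb_tr !sum_cfunE rmorph_sum /= [RHS](reindex_inj inj_u) /=.
by apply: eq_big => [j|j _]; rewrite ?aut_galois_orbit // aut_IirrE cfunE.
Qed.

Lemma orb_tr_int gT (G : {group gT}) (i : Iirr G) x :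
  orb_tr i x \in Num.int.
Proof.
have char_i: orb_tr i \is a character.
  by apply: rpred_sum => j _; apply: irr_char.
have [/order_dvdG dvd_x | /cfun0->] := boolP (x \in G); last exact: rpred0.
apply: Cint_rat_Aint (Aint_char x char_i).
have [Qn galQn [QnC gQnC [_ _ Qn_g]]] := group_num_field_exists G.
have [a Da] := Qn_g _ G _ char_i x dvd_x.
suffices /vlineP[c Dc] : a \in (1%VS : {vspace Qn}).
  by rewrite -Da Dc alg_num_field fmorph_rat Crat_rat.
have <- := galois_fixedField galQn.
apply/fixedFieldP=> [|nu _]; first exact: memvf.
have [u Du] := gQnC nu.
by apply: (fmorph_inj QnC); rewrite Du Da aut_orb_tr.
Qed.

Lemma probe_mxE gT (G : {group gT}) (i : Iirr G) (C : 'I_#|classes G|) x :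
  x \in enum_val C -> (probe_mx G i C)%:~R = orb_tr i x.
Proof.
rewrite mxE floorK ?orb_tr_int //; have /imsetP[y Gy ->] := enum_valP C.
move=> /imsetP[z Gz ->]; have [t Gt ->] := repr_class G y.
by rewrite !cfunJ.
Qed.

Lemma rank_over_span (F : fieldType) n m (s : m.-tuple 'rV[int]_n) :
  rank_over F (inIntSpan s)
    = \rank (\matrix_(i < m) map_mx intr s`_i : 'M[F]_(m, n)).
Proof.
set S := \matrix_i _; apply/eqP; rewrite eqn_leq; apply/andP; split.
  apply/bigmax_leqP=> r /asboolP[A spanA /eqP<-].
  apply/mxrankS/row_subP=> i; rewrite -map_row.
  have [a ->] := spanA i; rewrite map_mx_sum.
  apply: summx_sub => j _.
  suffices ->: map_mx intr (s`_j *~ a j) = (a j)%:~R *: row j S.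
    by rewrite scalemx_sub ?row_sub.
  rewrite -scaler_int intz rowK; apply/rowP=> k.
  by rewrite !mxE rmorphM.
have ltSn: (\rank S < n.+1)%N by rewrite ltnS rank_leq_col.
apply: (@leq_bigmax_cond _ _ _ (Ordinal ltSn)); apply/asboolP.
exists (\matrix_i s`_(maxrankfun S i)) => [i|].
  rewrite rowK; exists [ffun j => (j == maxrankfun S i)%:R].
  rewrite (bigD1 (maxrankfun S i)) //= ffunE eqxx mulr1z big1 ?addr0 // => j.
  by rewrite ffunE => /negPf->; rewrite mulr0z.
suffices ->: map_mx intr (\matrix_i s`_(maxrankfun S i))
    = rowsub (maxrankfun S) S by apply: maxrowsub_free.
by apply/row_matrixP=> i; rewrite -map_row row_rowsub !rowK.
Qed.

(* Main.v *)
Require Import Defs.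
From mathcomp Require Import all_boot all_order all_algebra.
From mathcomp Require Import all_fingroup all_solvable all_field all_character.
From mathcomp Require Import boolp.

Import GroupScope GRing.Theory Num.Theory.
Local Open Scope ring_scope.

(** In a cyclic group of odd prime order p, every nontrivial irreducible
character is linear of order p, and sends a generator x to a primitive p-th
root of unity. Any two primitive p-th roots of unity are exchanged by a field
automorphism, so the nontrivial characters form a single Galois orbit
(cyclic_galois_orbit), whose sum is the regular character minus 1. The probe
matrix thus has only two distinct rows: 1 everywhere, for the trivial character,
and p - 1 at the class of 1 with -1 elsewhere, for all the others.

Hence the differences of rows are 0 and d, -d, where d is 2 - p at the class of
1 and 2 elsewhere, and the rank over a field F is 1 as soon as d is nonzero in
F. As p is odd, 2 - p and 2 are coprime, so that d is nonzero in every field: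
the ranks over the rationals and over all prime fields agree
(rank_over_M_char_prime), and the conductor is empty. *)

Lemma algC_rmorph_bij (u : {rmorphism algC -> algC}) : bijective u.
Proof. by exists (algC_invaut u); [apply: algC_autK | apply: algC_invautK]. Qed.

Lemma lin_char_cycle_inj {gT : finGroupType} {x : gT} {xi zeta : 'CF(<[x]>)} :
  xi \is a linear_char -> zeta \is a linear_char -> xi x = zeta x -> xi = zeta.
Proof.
move=> lin_xi lin_zeta eq_x; apply/cfun_inP=> _ /cycleP[k ->].
by rewrite !lin_charX ?cycle_id // eq_x.
Qed.

(** A linear character of a cyclic group is determined by its value at a
generator, so its powers become trivial exactly when those of that value do. *)
Lemma lin_char_cycle_prim_root {gT : finGroupType} {x : gT} {xi : 'CF(<[x]>)} :
  xi \is a linear_char -> #[xi]%CF.-primitive_root (xi x).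
Proof.
move=> lin_xi; set n := #[xi]%CF.
have n_gt0: (0 < n)%N by apply: cforder_lin_char_gt0.
have xi_n: xi x ^+ n = 1.
  by rewrite -exp_cfunE ?cycle_id // exp_cforder cfun1E cycle_id.
have [m prim_m m_dvd] := prim_order_exists n_gt0 xi_n.
suffices n_dvd: (n %| m)%N.
  by have /eqP->: n == m by rewrite eqn_dvd n_dvd.
rewrite dvdn_cforder; apply/eqP/lin_char_cycle_inj.
- exact: rpredX.
- exact: cfun1_lin_char.
- by rewrite exp_cfunE ?cycle_id // (prim_expr_order prim_m) cfun1E cycle_id.
Qed.

(** The values of both characters at a generator are primitive roots of unity
of the same order, so one is a power of the other with an exponent coprime to
that order, and raising to this power extends to an automorphism of algC. *)
Lemma cyclic_galois_orbit {gT : finGroupType} {G : {group gT}} {i j : Iirr G} :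
  cyclic G -> #['chi_i]%CF = #['chi_j]%CF -> j \in galois_orbit i.
Proof.
move=> /cyclicP[x defG]; have {defG} eqG: G = <[x]>%G by apply: val_inj.
subst G => eq_ord.
have lin (k : Iirr <[x]>) : 'chi_k \is a linear_char.
  by apply/char_abelianP; apply: cycle_abelian.
have prim_i := lin_char_cycle_prim_root (lin i).
have prim_j := lin_char_cycle_prim_root (lin j).
rewrite -eq_ord in prim_j.
have [k Dk] := prim_rootP prim_i (prim_expr_order prim_j).
rewrite Dk prim_root_exp_coprime // in prim_j.
have [u Du] := Qn_aut_exists prim_j.
rewrite inE; apply/asboolP; exists u; first exact: algC_rmorph_bij.
apply/irr_inj/(lin_char_cycle_inj (lin _) (lin _)).
by rewrite Dk aut_IirrE cfunE Du // (prim_expr_order prim_i).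
Qed.

Lemma galois_orbit0 {gT : finGroupType} (G : {group gT}) :
  galois_orbit (0 : Iirr G) = [set 0].
Proof.
apply/setP=> j; rewrite !inE; apply/asboolP/eqP=> [[u _ ->] | ->].
  by rewrite aut_Iirr0.
exists (idfun : {rmorphism algC -> algC}); first exact: algC_rmorph_bij.
by rewrite aut_Iirr0.
Qed.

Lemma galois_orbit_neq0 {gT : finGroupType} {G : {group gT}} {i j : Iirr G} :
  j \in galois_orbit i -> (j == 0) = (i == 0).
Proof. by rewrite inE => /asboolP[u _ ->]; rewrite aut_Iirr_eq0. Qed.

Lemma cforder_irr_prime {gT : finGroupType} {G : {group gT}} (i : Iirr G) :
  prime #|G| -> i != 0 -> #['chi_i]%CF = #|G|.
Proof.
move=> prG nz_i.
have lin_i: 'chi_i \is a linear_char.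
  by apply/char_abelianP/cyclic_abelian/prime_cyclic.
have := cforder_lin_char_dvdG lin_i; case/primeP: prG => _ dvdG /dvdG.
case/orP=> /eqP // ord1; case/eqP: nz_i.
by apply/irr_inj; rewrite irr0 -(expr1 'chi_i) -ord1 exp_cforder.
Qed.

(** The nontrivial characters form one Galois orbit, and all characters are
linear, so the sum over that orbit is the regular character minus 1. *)
Lemma orb_tr_prime {gT : finGroupType} {G : {group gT}} (i : Iirr G) (x : gT) :
  prime #|G| -> x \in G ->
  orb_tr i x = if i == 0 then 1 else #|G|%:R *+ (x == 1%g) - 1.
Proof.
move=> prG Gx; have cycG := prime_cyclic prG.
rewrite /orb_tr; have [-> | nz_i] := eqVneq i 0.
  by rewrite galois_orbit0 big_set1 irr0 cfun1E Gx.
rewrite -cfRegE cfReg_sum [in RHS](bigD1 0) //= irr0 !cfunE !cfun1E Gx group1.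
rewrite mulr1 addrC addKr; congr (fun_of_cfun _ x).
apply: eq_big => [j | j _].
  apply/idP/idP => [/galois_orbit_neq0-> // | nz_j].
  by apply: cyclic_galois_orbit => //; rewrite !cforder_irr_prime.
have lin_j: 'chi_j \is a linear_char.
  by apply/char_abelianP/cyclic_abelian.
by rewrite lin_char1 // scale1r.
Qed.

(** The stacked matrix of the generators has the same row space as the single
row d, whose rank is 1 as long as d does not vanish in F. *)
Lemma rank_over_line (F : fieldType) n m (s : m.-tuple 'rV[int]_n)
    (d : 'rV[int]_n) :
    d \in tval s -> (forall v, v \in tval s -> exists a, v = a *: d) ->
  map_mx intr d != 0 :> 'rV[F]_n -> rank_over F (inIntSpan s) = 1%N.
Proof.
move=> s_d s_line nz_d; rewrite rank_over_span; set S := \matrix_i _.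
suffices /eqmxP->: (S == (map_mx intr d : 'rV[F]_n))%MS.
  by rewrite rank_rV nz_d.
apply/andP; split.
  apply/row_subP=> i; rewrite rowK.
  have [|a ->] := s_line s`_i; first by rewrite mem_nth ?size_tuple.
  by rewrite map_mxZ scalemx_sub.
case/tnthP: s_d => i ->; apply: (eq_row_sub i).
by rewrite rowK (tnth_nth 0).
Qed.

Lemma probe_mx_prime {gT : finGroupType} {G : {group gT}} (i : Iirr G) c x :
    prime #|G| -> x \in (enum_val c : {set gT}) ->
  probe_mx G i c = if i == 0 then 1 else #|G|%:Z *+ (x == 1%g) - 1.
Proof.
move=> prG c_x; apply: (@intr_inj algC); rewrite (probe_mxE _ c_x).
have Gx: x \in G.
  have /imsetP[y Gy Dc] := enum_valP c; move: c_x; rewrite Dc.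
  by apply/subsetP/class_subG.
rewrite orb_tr_prime //; case: eqP => // _.
by rewrite rmorphB rmorphMn /= pmulrn.
Qed.

Lemma exists_Iirr_neq0 {gT : finGroupType} {G : {group gT}} :
  prime #|G| -> exists i : Iirr G, i != 0.
Proof.
move=> prG; have lt1: (1 < Nirr G)%N.
  by rewrite NirrE classes_gt1 -cardG_gt1 prime_gt1.
by exists (Ordinal lt1).
Qed.

(** All nontrivial characters share one row of the probe matrix, so all row
differences are multiples of d, the trivial row minus that row. Oddness of the
order keeps d nonzero in every field, including those of characteristic 2. *)
Lemma rank_over_M_char_prime {gT : finGroupType} {G : {group gT}}
    (F : fieldType) :
  prime #|G| -> odd #|G| -> rank_over F (M_char G) = 1%N.
Proof.
move=> prG oddG; have [k nz_k] := exists_Iirr_neq0 prG.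
set P := probe_mx G; pose d := row 0 P - row k P.
have rowPE i : row i P = (i == 0)%:R *: d + row k P.
  have [-> | nz_i] := eqVneq i 0; first by rewrite scale1r subrK.
  rewrite scale0r add0r; apply/rowP=> c; have /imsetP[x _ Dc] := enum_valP c.
  have c_x: x \in enum_val c by rewrite Dc class_refl.
  by rewrite [LHS]mxE [RHS]mxE !(probe_mx_prime _ _ _ prG c_x) (negPf nz_i) (negPf nz_k).
apply: (@rank_over_line _ _ _ _ d) => [|v /mapP[[i j] _ ->] /=|].
- by apply/mapP; exists (0, k); rewrite ?mem_enum.
- exists ((i == 0)%:R - (j == 0)%:R).
  by rewrite [row i _]rowPE [row j _]rowPE [X in _ - X]addrC addrKA scalerBl.
have dE c : d 0 c = P 0 c - P k c.
  by rewrite [LHS]mxE [X in _ + X]mxE; congr (_ - _); apply: mxE.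
have d_at x : x \in G ->
    exists c, (d 0 c)%:~R = 2 - (#|G|%:R *+ (x == 1%g)) :> F.
  move=> Gx; have Gcx: x ^: G \in classes G by apply: mem_classes.
  exists (enum_rank_in Gcx (x ^: G)).
  have c_x: x \in enum_val (enum_rank_in Gcx (x ^: G)).
    by rewrite enum_rankK_in ?class_refl.
  rewrite dE !(probe_mx_prime _ _ _ prG c_x) eqxx (negPf nz_k) opprB addrA.
  by rewrite rmorphB rmorphMn /= -pmulrn.
have /trivgPn[x Gx ntx]: G :!=: 1%g by rewrite -cardG_gt1 prime_gt1.
apply/eqP=> d0; have d0c c : (d 0 c)%:~R = 0 :> F.
  by move/rowP/(_ c): d0; rewrite mxE [RHS]mxE.
(* If d vanished in F then 2 and 2 - #|G|, its entries at the classes of x and *)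
(* 1, would both be 0 in F, and so would the odd number #|G|, hence also 1.    *)
have [c] := d_at x Gx; rewrite d0c (negPf ntx) subr0 => two0.
have [c1] := d_at 1%g (group1 G); rewrite d0c eqxx -two0 sub0r => /eqP.
rewrite eq_sym oppr_eq0 -(odd_double_half #|G|) oddG natrD -mul2n natrM -two0.
by rewrite mul0r addr0 oner_eq0.
Qed.

Theorem theorem7p3 (p : nat) (p_pr : prime p) (p_odd : odd p) :
  ~ (forall (gT : finGroupType) (G : {group gT}),
       (exists2 xi : 'CF(G), xi \is a linear_char & #[xi]%CF = p) ->
       p \in C_char G)
  /\ (forall (gT : finGroupType) (G : {group gT}), cyclic G -> #|G| = p ->
       [/\ exists2 xi : 'CF(G), xi \is a linear_char & #[xi]%CF = p,
           C_char G =i pred0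
         & p \notin C_char G]).
Proof.
have main (gT : finGroupType) (G : {group gT}) : #|G| = p ->
    (exists2 xi : 'CF(G), xi \is a linear_char & #[xi]%CF = p)
    /\ C_char G =i pred0.
  move=> oG; split; last first.
    by move=> q; rewrite !inE !rank_over_M_char_prime ?oG // ltnn andbF.
  rewrite -oG in p_pr *; have [i nz_i] := exists_Iirr_neq0 p_pr.
  exists 'chi_i; last exact: cforder_irr_prime.
  by apply/char_abelianP/cyclic_abelian/prime_cyclic.
split=> [all_p | gT G _ /main[exG C0]]; last by split; rewrite ?C0.
have [|exZ C0] := main _ (Zp p); first by rewrite card_Zp ?prime_gt0.
by have := all_p _ _ exZ; rewrite C0.
Qed.
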